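(* For every $\kappa>0$ and for every $L>0$, $\psi_L(\kappa)>q(\kappa)$.
   Context: For $\kappa\ge 0$ and a real parameter $L>0$: $$q(\kappa)=\frac{(\kappa-1)^2}{(\kappa+1)^2},\qquad \psi_L(\kappa)=e^{L\kappa}\cdot f(\cos g_L(\kappa)),\qquad f(t)=(2-t)-\sqrt{(2-t)^2-1},$$ $$g_L(\kappa)=L\kappa-\hat g(\kappa),$$ where, with $R(\kappa)=\frac{4\kappa(\kappa^2-1)}{\kappa^4-6\kappa^2+1}$ and the branch of $\arctan$ with $\arctan(0)=0$, $$\hat g(\kappa)=\begin{cases}\arctan R(\kappa) & 0\le\kappa<\sqrt2-1,\\ -\pi/2 & \kappa=\sqrt2-1,\\ -\pi+\arctan R(\kappa) & \sqrt2-1<\kappa<\sqrt2+1,\\ -3\pi/2 & \kappa=\sqrt2+1,\\ -2\pi+\arctan R(\kappa) & \kappa>\sqrt2+1.\end{cases}$$ *)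

(* Defs.v *)
From Stdlib Require Import Reals.
Open Scope R_scope.

Definition q (k : R) : R := (k - 1) ^ 2 / (k + 1) ^ 2.

Definition f (t : R) : R := (2 - t) - sqrt ((2 - t) ^ 2 - 1).

Definition ratio (k : R) : R :=
  4 * k * (k ^ 2 - 1) / (k ^ 4 - 6 * k ^ 2 + 1).

(* [atan] takes values in ]-PI/2, PI/2[, so it is the branch with [atan 0 = 0].
   The denominator of [ratio] vanishes for k >= 0 exactly at [sqrt 2 - 1] and
   [sqrt 2 + 1], where [ratio] is not used. Only k >= 0 is meaningful: for
   negative k the first case applies by totality. *)
Definition ghat (k : R) : R :=
  if Rlt_dec k (sqrt 2 - 1) then atan (ratio k)
  else if Req_dec_T k (sqrt 2 - 1) then - PI / 2
  else if Rlt_dec k (sqrt 2 + 1) then - PI + atan (ratio k)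
  else if Req_dec_T k (sqrt 2 + 1) then - (3 * PI) / 2
  else - (2 * PI) + atan (ratio k).

Definition g (L k : R) : R := L * k - ghat k.

Definition psi (L k : R) : R := exp (L * k) * f (cos (g L k)).

(* Main.v *)
Require Import Defs.
From Stdlib Require Import Reals.
From Stdlib Require Import Lra.
Open Scope R_scope.

(** Put [theta = atan k]. The case distinction in [ghat] follows one continuous
    branch: [ratio k = - tan (4 * theta)] and [ghat k = - 4 * theta]
    ([ghat_atan]), so [g L k = 2 * (h + 2 * theta)] with [h = L * k / 2].

    Hyperbolic coordinates turn both sides into exponentials. Since
    [2 - cos (2 * u) = 1 + 2 * (sin u) ^ 2 = cosh (2 * w)] when
    [sinh w = Rabs (sin u)], one gets [f (cos (2 * u)) = exp (- 2 * w)]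
    ([f_cos_double]), and hence [psi L k = exp (2 * h - 2 * w)] for
    [u = h + 2 * theta]. For [k <> 1] write [q k = exp (- 2 * a)] with [a > 0].
    The inequality to prove is thus [w < h + a], that is [Rabs (sin (h + 2 * theta)) < sinh (h + a)].

    At [h = 0] the comparison is between
    [sin (2 * theta) = 2 * k / (1 + k ^ 2)] and
    [sinh a = 2 * k / Rabs (1 - k ^ 2)] ([q_exp]). As [h] grows, the left side
    grows at rate at most 1 ([Rabs_sin_plus_le]) and the right side at rate more
    than 1 ([sinh_plus_gt]). For [k = 1] one has [q k = 0], while [psi] is
    positive. *)

(** * The phase is [- 4 * atan k] *)

(** The tangent determines an angle up to a multiple of [PI]; the bounds
    on [z] single out the value of [atan]. *)
Lemma atan_quotient (z n d c : R) :
  0 < c -> - PI / 2 < z < PI / 2 -> sin z * c = n -> cos z * c = d ->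
  atan (n / d) = z.
Proof.
  intros Hc Hz Hn Hd.
  assert (Hcos : 0 < cos z) by (apply cos_gt_0; lra).
  replace (n / d) with (tan z); [apply atan_tan; lra |].
  subst n d; unfold tan; field; lra.
Qed.

Lemma one_plus_sqr_pos (k : R) : 0 < 1 + k ^ 2.
Proof. pose proof (pow2_ge_0 k); lra. Qed.

Lemma sin_2_atan (k : R) : sin (2 * atan k) = 2 * k / (1 + k ^ 2).
Proof.
  pose proof (one_plus_sqr_pos k) as Hk.
  rewrite sin_2a, sin_atan, cos_atan, Rsqr_pow2.
  pose proof (sqrt_lt_R0 _ Hk); pose proof (pow2_sqrt _ (Rlt_le _ _ Hk)) as E.
  rewrite <- E at 3; field; lra.
Qed.

Lemma cos_2_atan (k : R) : cos (2 * atan k) = (1 - k ^ 2) / (1 + k ^ 2).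
Proof.
  pose proof (one_plus_sqr_pos k) as Hk.
  rewrite cos_2a, sin_atan, cos_atan, Rsqr_pow2.
  pose proof (sqrt_lt_R0 _ Hk); pose proof (pow2_sqrt _ (Rlt_le _ _ Hk)) as E.
  rewrite <- E at 5; field; lra.
Qed.

Lemma sin_4_atan (k : R) :
  sin (4 * atan k) * (1 + k ^ 2) ^ 2 = - (4 * k * (k ^ 2 - 1)).
Proof.
  pose proof (one_plus_sqr_pos k).
  replace (4 * atan k) with (2 * (2 * atan k)) by ring.
  rewrite sin_2a, sin_2_atan, cos_2_atan; field; lra.
Qed.

Lemma cos_4_atan (k : R) :
  cos (4 * atan k) * (1 + k ^ 2) ^ 2 = k ^ 4 - 6 * k ^ 2 + 1.
Proof.
  pose proof (one_plus_sqr_pos k).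
  replace (4 * atan k) with (2 * (2 * atan k)) by ring.
  rewrite cos_2a, sin_2_atan, cos_2_atan; field; lra.
Qed.

Lemma sqrt2_bounds : 1 < sqrt 2 < 2.
Proof.
  pose proof (sqrt_pos 2); pose proof (pow2_sqrt 2 ltac:(lra)); nra.
Qed.

(** [tan (PI / 8)] is the positive root of [2 * x = 1 - x ^ 2]. *)
Lemma atan_sqrt2_minus_1 : atan (sqrt 2 - 1) = PI / 8.
Proof.
  pose proof sqrt2_bounds; pose proof (pow2_sqrt 2 ltac:(lra)) as Hsq.
  set (x := sqrt 2 - 1).
  assert (Hx : 2 * x = 1 - x ^ 2) by (unfold x; nra).
  assert (Hlo : 0 < atan x)
    by (rewrite <- atan_0; apply atan_increasing; unfold x; lra).
  assert (Hhi : atan x < PI / 4)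
    by (rewrite <- atan_1; apply atan_increasing; unfold x; lra).
  pose proof (one_plus_sqr_pos x).
  assert (H1 : atan (2 * x / (1 - x ^ 2)) = 2 * atan x).
  { apply atan_quotient with (1 + x ^ 2); try lra.
    - rewrite sin_2_atan; field; lra.
    - rewrite cos_2_atan; field; lra. }
  replace (2 * x / (1 - x ^ 2)) with 1 in H1
    by (rewrite Hx; field; unfold x in *; lra).
  rewrite atan_1 in H1; lra.
Qed.

Lemma atan_sqrt2_plus_1 : atan (sqrt 2 + 1) = 3 * PI / 8.
Proof.
  pose proof sqrt2_bounds; pose proof (pow2_sqrt 2 ltac:(lra)) as Hsq.
  replace (sqrt 2 + 1) with (/ (sqrt 2 - 1)).
  - rewrite atan_inv, atan_sqrt2_minus_1 by lra; lra.
  - apply Rmult_eq_reg_r with (sqrt 2 - 1); [| lra].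
    rewrite Rinv_l by lra; nra.
Qed.

Lemma ghat_atan (k : R) : 0 < k -> ghat k = - (4 * atan k).
Proof.
  intros Hk.
  pose proof (sin_4_atan k) as Hs; pose proof (cos_4_atan k) as Hc.
  pose proof (one_plus_sqr_pos k).
  assert (Hp : 0 < (1 + k ^ 2) ^ 2) by (apply pow_lt; lra).
  assert (Hpos : 0 < atan k) by (rewrite <- atan_0; apply atan_increasing; lra).
  pose proof (atan_bound k) as Hbd.
  unfold ghat, ratio.
  destruct (Rlt_dec k (sqrt 2 - 1)) as [H1 | H1].
  { pose proof (atan_increasing _ _ H1) as Hi; rewrite atan_sqrt2_minus_1 in Hi.
    apply atan_quotient with ((1 + k ^ 2) ^ 2); try lra.
    - rewrite sin_neg; lra.
    - rewrite cos_neg; lra. }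
  destruct (Req_dec_T k (sqrt 2 - 1)) as [H2 | H2].
  { rewrite H2, atan_sqrt2_minus_1; lra. }
  pose proof (atan_increasing (sqrt 2 - 1) k ltac:(lra)) as Hlo.
  rewrite atan_sqrt2_minus_1 in Hlo.
  destruct (Rlt_dec k (sqrt 2 + 1)) as [H3 | H3].
  { pose proof (atan_increasing _ _ H3) as Hi; rewrite atan_sqrt2_plus_1 in Hi.
    (* Shifting the angle by [PI] negates both its sine and its cosine, hence
       the sign change in the numerator and in the denominator. *)
    replace (4 * k * (k ^ 2 - 1) / (k ^ 4 - 6 * k ^ 2 + 1))
      with ((- (4 * k * (k ^ 2 - 1))) / (- (k ^ 4 - 6 * k ^ 2 + 1)))
      by (unfold Rdiv; rewrite Rinv_opp; ring).
    rewrite (atan_quotient (PI - 4 * atan k) _ _ ((1 + k ^ 2) ^ 2)); try lra.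
    - rewrite sin_PI_x; lra.
    - rewrite Rtrigo_facts.cos_pi_minus; lra. }
  destruct (Req_dec_T k (sqrt 2 + 1)) as [H4 | H4].
  { rewrite H4, atan_sqrt2_plus_1; lra. }
  pose proof (atan_increasing (sqrt 2 + 1) k ltac:(lra)) as Hhi.
  rewrite atan_sqrt2_plus_1 in Hhi.
  rewrite (atan_quotient (2 * PI - 4 * atan k) _ _ ((1 + k ^ 2) ^ 2)); try lra.
  - rewrite sin_minus, sin_2PI, cos_2PI; lra.
  - rewrite cos_minus, sin_2PI, cos_2PI; lra.
Qed.

(** * Both sides as exponentials *)

Lemma exp_mult_opp (x : R) : exp x * exp (- x) = 1.
Proof. rewrite <- exp_plus, Rplus_opp_r; apply exp_0. Qed.

(** With [t = 1 - 2 * (sinh w) ^ 2], [2 - t] is [cosh (2 * w)] and the square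
    root in [f t] is [sinh (2 * w)]. *)
Lemma f_sinh (w : R) : 0 <= w -> Defs.f (1 - 2 * sinh w ^ 2) = exp (- (2 * w)).
Proof.
  intros Hw; unfold Defs.f, sinh.
  replace (- (2 * w)) with (- w + - w) by ring; rewrite exp_plus.
  pose proof (exp_mult_opp w) as E.
  pose proof (exp_pos (- w)).
  assert (Hle : exp (- w) <= exp w) by (destruct Hw as [Hw | <-]; [left; apply exp_increasing; lra | rewrite Ropp_0; lra]).
  set (a := exp w) in *; set (b := exp (- w)) in *.
  replace (2 - (1 - 2 * ((a - b) / 2) ^ 2)) with ((a ^ 2 + b ^ 2) / 2) by nra.
  replace (((a ^ 2 + b ^ 2) / 2) ^ 2 - 1) with (((a ^ 2 - b ^ 2) / 2) ^ 2).
  - rewrite sqrt_pow2 by nra; field.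
  - replace 1 with ((a * b) ^ 2) by (rewrite E; ring); field.
Qed.

Lemma f_cos_double (u : R) :
  Defs.f (cos (2 * u)) = exp (- (2 * arcsinh (Rabs (sin u)))).
Proof.
  rewrite <- f_sinh, sinh_arcsinh, pow2_abs, cos_2a_sin.
  - f_equal; ring.
  - rewrite <- arcsinh_0; apply arcsinh_le, Rabs_pos.
Qed.

(** Here [exp (- a) = Rabs (k - 1) / (k + 1)], so that
    [sinh a = 2 * k / Rabs (1 - k ^ 2)]. *)
Lemma q_exp (k : R) :
  0 < k -> k <> 1 ->
  exists a, q k = exp (- (2 * a)) /\ sin (2 * atan k) <= sinh a.
Proof.
  intros Hk Hk1.
  set (m := Rabs (k - 1)).
  assert (Hm : 0 < m) by (apply Rabs_pos_lt; lra).
  assert (Hm2 : m ^ 2 = (k - 1) ^ 2) by apply pow2_abs.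
  assert (Hp : 0 < m / (k + 1)) by (apply Rdiv_lt_0_compat; lra).
  exists (- ln (m / (k + 1))); split.
  - replace (- (2 * - ln (m / (k + 1))))
      with (ln (m / (k + 1)) + ln (m / (k + 1))) by ring.
    rewrite exp_plus, exp_ln by exact Hp.
    unfold q; rewrite <- Hm2; field; lra.
  - unfold sinh; rewrite Ropp_involutive, exp_Ropp, exp_ln by exact Hp.
    replace ((/ (m / (k + 1)) - m / (k + 1)) / 2)
      with (2 * k / (m * (k + 1))).
    + rewrite sin_2_atan; unfold Rdiv.
      apply Rmult_le_compat_l; [lra |].
      apply Rinv_le_contravar; [nra |].
      unfold m, Rabs; destruct (Rcase_abs (k - 1)); nra.
    + replace (2 * k / (m * (k + 1)))
        with (((k + 1) ^ 2 - (k - 1) ^ 2) / (2 * m * (k + 1)))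
        by (field; lra).
      rewrite <- Hm2; field; lra.
Qed.

(** * Growth of the sine and of the hyperbolic sine *)

Lemma Rabs_sin_le (h : R) : 0 < h -> Rabs (sin h) <= h.
Proof.
  intros Hh; pose proof (sin_lt_x h Hh).
  apply Rabs_le; split; [| lra].
  destruct (Rle_dec h PI) as [Hpi | Hpi].
  - pose proof (sin_ge_0 h ltac:(lra) Hpi); lra.
  - pose proof (SIN_bound h); pose proof PI2_1; lra.
Qed.

Lemma Rabs_sin_plus_le (h b : R) :
  0 < h -> Rabs (sin (h + b)) <= h + Rabs (sin b).
Proof.
  intros Hh; rewrite sin_plus.
  eapply Rle_trans; [apply Rabs_triang |]; rewrite !Rabs_mult.
  pose proof (Rabs_sin_le h Hh).
  pose proof (Rabs_pos (sin h)); pose proof (Rabs_pos (sin b)).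
  pose proof (Rabs_le (cos h) 1 (COS_bound h)).
  pose proof (Rabs_le (cos b) 1 (COS_bound b)).
  nra.
Qed.

Lemma cosh_ge_1 (x : R) : 1 <= cosh x.
Proof.
  unfold cosh; pose proof (exp_mult_opp x).
  pose proof (exp_pos x); pose proof (exp_pos (- x)).
  pose proof (pow2_ge_0 (exp x - exp (- x))); nra.
Qed.

Lemma cosh_gt_1 (x : R) : 0 < x -> 1 < cosh x.
Proof.
  intros Hx; unfold cosh; pose proof (exp_mult_opp x).
  pose proof (exp_pos (- x)).
  assert (exp (- x) < exp x) by (apply exp_increasing; lra).
  nra.
Qed.

Lemma sinh_gt (x : R) : 0 < x -> x < sinh x.
Proof.
  intros Hx.
  destruct (MVT_cor2 sinh cosh 0 x Hx) as [c [E Hc]].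
  - intros; apply derivable_pt_lim_sinh.
  - pose proof (cosh_gt_1 c ltac:(lra)); rewrite sinh_0 in E; nra.
Qed.

Lemma sinh_plus (x y : R) :
  sinh (x + y) = sinh x * cosh y + cosh x * sinh y.
Proof.
  unfold sinh, cosh; rewrite Ropp_plus_distr, !exp_plus; field.
Qed.

Lemma sinh_plus_gt (h a : R) :
  0 < h -> 0 <= sinh a -> h + sinh a < sinh (h + a).
Proof.
  intros Hh Ha; rewrite sinh_plus.
  pose proof (sinh_gt h Hh); pose proof (cosh_ge_1 h); pose proof (cosh_ge_1 a).
  nra.
Qed.

(** * The inequality *)

Theorem mainTheorem2 :
  forall k : R, k > 0 -> forall L : R, L > 0 -> psi L k > q k.
Proof.
  intros k Hk L HL.
  assert (Hh : 0 < L * k / 2)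
    by (apply Rdiv_lt_0_compat; [apply Rmult_lt_0_compat |]; lra).
  unfold psi, g; rewrite ghat_atan by exact Hk.
  set (h := L * k / 2) in *.
  replace (L * k - - (4 * atan k)) with (2 * (h + 2 * atan k))
    by (unfold h; field).
  replace (L * k) with (2 * h) by (unfold h; field).
  rewrite f_cos_double, <- exp_plus.
  destruct (Req_dec k 1) as [-> | Hk1].
  { replace (q 1) with 0 by (unfold q; field); apply exp_pos. }
  destruct (q_exp k Hk Hk1) as [a [-> Ha]].
  apply exp_increasing.
  assert (Hs : 0 <= sin (2 * atan k)).
  { rewrite sin_2_atan; apply Rlt_le, Rdiv_lt_0_compat;
      [lra | apply one_plus_sqr_pos]. }
  pose proof (Rabs_sin_plus_le h (2 * atan k) Hh) as Hsin.
  rewrite (Rabs_pos_eq _ Hs) in Hsin.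
  pose proof (sinh_plus_gt h a Hh ltac:(lra)).
  assert (Hw : arcsinh (Rabs (sin (h + 2 * atan k))) < h + a).
  { rewrite <- (arcsinh_sinh (h + a)); apply arcsinh_lt; lra. }
  lra.
Qed.
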